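(* Fix $0<\lambda<1$ and an integer $k_0\ge0$, and put $\nu=1-\lambda$. (a) When $0<\delta<1$ is fixed and $n\to\infty$, $$\overline{\epsilon}_0(k_0,n,\delta)=\frac{k_0+1-\delta}{\delta}\,n^{-1}+o(n^{-1}),\qquad \overline{\epsilon}_\lambda(\lceil\nu k_0\rceil,n,\delta)=G(\lceil\nu k_0\rceil,\delta,\lambda)\,n^{-1}+o(n^{-1}).$$ (b) When $\delta=\mathrm{e}^{-rn}$ with a fixed constant $r>0$ and $n\to\infty$: for all sufficiently large $n$, $\overline{\epsilon}_0(k_0,n,\mathrm{e}^{-rn})=1$; if $r>\ln\lambda^{-1}$ then $\overline{\epsilon}_\lambda(\lceil\nu k_0\rceil,n,\mathrm{e}^{-rn})=1$ for all sufficiently large $n$; and if $0<r\le\ln\lambda^{-1}$ then $$\overline{\epsilon}_\lambda(\lceil\nu k_0\rceil,n,\mathrm{e}^{-rn})=\frac{r}{r+\lambda(\ln\lambda^{-1}-r)}+o(1).$$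
   Context: Let $\mathcal Q_{n+1}$ be the set of permutation-invariant (exchangeable) probability distributions of $(Y_1,\dots,Y_{n+1})\in\{0,1\}^{n+1}$. For $0\le\lambda<1$ put $\nu:=1-\lambda$. Given $(Y_1,\dots,Y_{n+1})$, let $U_1,\dots,U_n\in\{0,1\}$ be conditionally independent, $U_i$ depending only on $Y_i$, with $P(U_i=1|Y_i=0)=0$, $P(U_i=1|Y_i=1)=\nu$, $P(U_i=0|Y_i=1)=\lambda$. Put $L:=\sum_{i=1}^nU_i$. For $Q\in\mathcal Q_{n+1}$, $Q(\cdot)$ also denotes probability under the resulting joint law. For integers $0\le l\le n-1$ and $0<\delta\le1$ define $$\overline{\epsilon}_\lambda(l,n,\delta):=\max_{Q\in\mathcal Q_{n+1}}\{Q(Y_{n+1}=1|L\le l)\;:\;Q(L\le l)\ge\delta\}.$$ (For $\lambda=0$, $L=\sum_{i=1}^n Y_i$.) For integers $z,l\ge0$: $B_{z,l}:=\sum_{j=0}^l\binom zj\nu^j\lambda^{z-j}$ (with $\binom zj=0$ for $j>z$), $\Delta_{z,l}:=B_{z,l}-B_{z+1,l}$. For $0<\delta\le1$: $z^*=z^*(l,\delta,\lambda):=\min\{z\in\mathbb Z,\ z\ge l: B_{z,l}\le\delta\}$ and $z_*=z_*(l,\delta,\lambda):=z^*-1$. Define $$G(l,\delta,\lambda):=\frac{(B_{z_*,l}-\delta)\,z^*B_{z_*,l}+(\delta-B_{z^*,l})\,z_*B_{z_*-1,l}}{\delta\,\Delta_{z_*,l}},$$ where the term $z_*B_{z_*-1,l}$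 is understood to be $0$ if $z_*=0$. *)

(* Defs.v *)
From mathcomp Require Import all_boot all_order all_algebra all_fingroup.
From mathcomp Require Import all_classical all_reals all_analysis.

Set Implicit Arguments.
Unset Strict Implicit.
Unset Printing Implicit Defensive.

Import Order.TTheory GRing.Theory Num.Theory.
Import numFieldNormedType.Exports.

Local Open Scope classical_set_scope.
Local Open Scope ring_scope.

(* Maximum and minimum in the strict sense: the value must be attained.
   The default x0 is returned only when no such element exists. *)
Definition set_max d (T : porderType d) (x0 : T) (A : set T) : T :=
  xget x0 (A `&` ubound A).
Definition set_min d (T : porderType d) (x0 : T) (A : set T) : T :=
  xget x0 (A `&` lbound A).

Section Model.
Variables (R : realType) (n : nat).

(* (Y_1, ..., Y_{n+1}) is indexed from 0, so Y_{n+1} is the entry at ord_max. *)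
Definition Yspace := {ffun 'I_n.+1 -> bool}.
Definition Uspace := {ffun 'I_n -> bool}.

Definition distribution (Q : Yspace -> R) :=
  (forall y, 0 <= Q y) /\ \sum_y Q y = 1.

Definition exchangeable (Q : Yspace -> R) :=
  forall (s : 'S_n.+1) (y : Yspace), Q [ffun i => y (s i)] = Q y.

(* P(U_i = u | Y_i = y) *)
Definition kernel (lambda : R) (y u : bool) : R :=
  if y then (if u then 1 - lambda else lambda) else (if u then 0 else 1).

Definition joint (lambda : R) (Q : Yspace -> R) (w : Yspace * Uspace) : R :=
  Q w.1 * \prod_(i < n) kernel lambda (w.1 (widen_ord (leqnSn n) i)) (w.2 i).

Definition Pr (lambda : R) (Q : Yspace -> R) (E : pred (Yspace * Uspace)) : R :=
  \sum_(w | E w) joint lambda Q w.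

Definition condPr (lambda : R) (Q : Yspace -> R)
    (E F : pred (Yspace * Uspace)) : R :=
  Pr lambda Q (predI E F) / Pr lambda Q F.

Definition Ylast : pred (Yspace * Uspace) := fun w => w.1 ord_max.

Definition L (w : Yspace * Uspace) : nat := (\sum_(i < n) w.2 i)%N.

Definition L_le (l : nat) : pred (Yspace * Uspace) := fun w => (L w <= l)%N.

End Model.

Arguments Ylast {n}.
Arguments L_le {n}.

Definition eps (R : realType) (lambda : R) (l n : nat) (delta : R) : R :=
  set_max 0 [set condPr lambda Q Ylast (L_le l) | Q in
    [set Q : Yspace n -> R |
      [/\ distribution Q, exchangeable Q & delta <= Pr lambda Q (L_le l)]]].

Section Coefficient.
Variable R : realType.
Implicit Types (lambda delta : R) (z l : nat).

Definition B lambda z l : R :=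
  \sum_(0 <= j < l.+1) 'C(z, j)%:R * (1 - lambda) ^+ j * lambda ^+ (z - j).

Definition Delta lambda z l : R := B lambda z l - B lambda z.+1 l.

Definition zup l delta lambda : nat :=
  set_min 0%N [set z : nat | (l <= z)%N /\ B lambda z l <= delta].

(* For 0 < lambda < 1 and delta < 1 one has zup > l, so the truncated
   predecessor is the integer one.  In G the product zdn * B (zdn - 1) vanishes
   when zdn = 0, whatever the value of B at the truncated index. *)
Definition zdn l delta lambda : nat := (zup l delta lambda).-1.

Definition G l delta lambda : R :=
  let zu := zup l delta lambda in
  let zd := zdn l delta lambda in
  ((B lambda zd l - delta) * (zu%:R * B lambda zd l)
   + (delta - B lambda zu l) * (zd%:R * B lambda zd.-1 l))
  / (delta * Delta lambda zd l).

End Coefficient.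

(* ceil((1 - lambda) k0) as a natural number; the argument of the ceiling is
   nonnegative for lambda <= 1. *)
Definition ceil_nu (R : realType) (lambda : R) (k0 : nat) : nat :=
  `|Num.ceil ((1 - lambda) * k0%:R)|%N.

(* Main.v *)
Require Import Defs.
From mathcomp Require Import all_boot all_order all_algebra.
From mathcomp Require Import all_classical all_reals all_analysis.
From mathcomp Require Import perm ring lra zify.
Import Order.TTheory GRing.Theory Num.Theory.
Import numFieldNormedType.Exports.
Local Open Scope classical_set_scope.
Local Open Scope ring_scope.

(** Why the theorem holds.

    By exchangeability only the number [z] of ones among the [n + 1] variables
    matters: [P(L <= l)] and [P(Y_{n+1} = 1, L <= l)] are averages over [z] of
    [hit z] and [hitlast z] ([Pr_L_le], [Pr_Ylast_L_le]), where
    [hitlast z = z / (n + 1) * B (z - 1)] and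
    [hit z = hitlast z + (1 - z / (n + 1)) * B z]. The maximum defining [eps]
    exists by compactness ([eps_max]). Hence an inequality
    [hitlast z <= v * hit z + c * delta] valid at every level [z] bounds [eps]
    by [v + c] ([eps_le_of_levels]), and a mixture of two levels bounds it from
    below ([eps_ge_levels]).

    For fixed [delta], the points [(hit z, (n + 1) * hitlast z)] tend to
    [(B z, z * B (z - 1))]. These limit points form a concave chain
    ([hull_max]), so the optimum at the abscissa [delta] lies on the segment
    between the consecutive levels [zdn] and [zup] that enclose [delta]; its
    ordinate divided by [delta] is [G]. The supporting line and the mixture of
    these two levels stay valid for finite [n] up to [O(n^-2)]
    ([eps_expansion]). For [lambda = 0] the two levels are [k0] and [k0 + 1];
    for [lambda > 0] the concavity rests on the single inequality
    [B_ratio_le] between consecutive values of [B], obtained term by term.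

    For [delta = exp (- r n)], the ratio [B (z + 1) / B z] tends to [lambda], so
    [hit z] behaves like [lambda ^ z] on the exponential scale and the feasible
    levels are those up to about [rho * n], [rho = r / ln (1 / lambda)]. At the
    level [x * n] the ratio of [hitlast] to [hit] is about
    [x / (x + lambda * (1 - x))], increasing in [x]; at [x = rho] this is the
    stated limit. Levels significantly above [rho * n] contribute a negligible
    part of the probability, which is at least [delta]. When
    [r > ln (1 / lambda)] all variables may be 1, and without failures
    [k0 + 1] ones are enough: both give conditional probability 1. *)

Set Implicit Arguments.
Unset Strict Implicit.
Unset Printing Implicit Defensive.

(** * Binomial tails *)

Lemma B_ge0 (R : realType) (lambda : R) (z l : nat) :
  0 <= lambda <= 1 -> 0 <= B lambda z l.
Proof.
move=> /andP[l0 l1]; apply: sumr_ge0 => j _.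
by rewrite !mulr_ge0 ?ler0n ?exprn_ge0 ?subr_ge0.
Qed.

Lemma DeltaE (R : realType) (lambda : R) (z l : nat) :
  Delta lambda z l = 'C(z, l)%:R * (1 - lambda) ^+ l.+1 * lambda ^+ (z - l).
Proof.
elim: l => [|l IH].
  by rewrite /Delta /B !big_nat1 !bin0 !subn0 exprS; ring.
have -> : Delta lambda z l.+1 = Delta lambda z l +
    ('C(z, l.+1)%:R * (1 - lambda) ^+ l.+1 * lambda ^+ (z - l.+1) -
     'C(z.+1, l.+1)%:R * (1 - lambda) ^+ l.+1 * lambda ^+ (z.+1 - l.+1)).
  by rewrite /Delta /B !(big_nat_recr l.+1) //=; ring.
rewrite IH binS natrD subSS.
have [ltlz|lezl] := ltnP l z.
  by rewrite (_ : (z - l = (z - l.+1).+1)%N) ?exprS; [ring | lia].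
by rewrite (@bin_small z l.+1) // !mul0r; ring.
Qed.

Lemma B_le1E (R : realType) (lambda : R) (z l : nat) :
  (z <= l)%N -> B lambda z l = 1.
Proof.
elim: z => [|z IH] zl.
  rewrite /B big_nat_recl // big1 ?bin0 ?expr0 ?mulr1 ?addr0 // => j _.
  by rewrite bin_small // !mul0r.
have := DeltaE lambda z l.
by rewrite bin_small // /Delta IH ?(ltnW zl) // !mul0r => /subr0_eq <-.
Qed.

Lemma Delta_ge0 (R : realType) (lambda : R) (z l : nat) :
  0 <= lambda <= 1 -> 0 <= Delta lambda z l.
Proof.
move=> /andP[l0 l1].
by rewrite DeltaE !mulr_ge0 ?ler0n ?exprn_ge0 ?subr_ge0.
Qed.

Lemma Delta_gt0 (R : realType) (lambda : R) (z l : nat) :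
  0 < lambda < 1 -> (l <= z)%N -> 0 < Delta lambda z l.
Proof.
move=> /andP[l0 l1] lz.
by rewrite DeltaE !mulr_gt0 ?exprn_gt0 ?subr_gt0 ?ltr0n ?bin_gt0.
Qed.

Lemma B_nonincreasing (R : realType) (lambda : R) (l z z' : nat) :
  0 <= lambda <= 1 -> (z <= z')%N -> B lambda z' l <= B lambda z l.
Proof.
move=> lam /subnK <-; elim: (z' - z)%N => [//|k IH].
by rewrite addSn (le_trans _ IH) // -subr_ge0 Delta_ge0.
Qed.

Lemma B_le1 (R : realType) (lambda : R) (z l : nat) :
  0 <= lambda <= 1 -> B lambda z l <= 1.
Proof. by move=> lam; rewrite -(B_le1E lambda (leq0n l)) B_nonincreasing. Qed.

(** Only the term of index 0 is kept: no success at all. *)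
Lemma B_ge_exp (R : realType) (lambda : R) (z l : nat) :
  0 <= lambda <= 1 -> lambda ^+ z <= B lambda z l.
Proof.
move=> /andP[l0 l1]; rewrite /B big_nat_recl // bin0 expr0 subn0 !mul1r lerDl.
by apply: sumr_ge0 => j _; rewrite !mulr_ge0 ?ler0n ?exprn_ge0 ?subr_ge0.
Qed.

Lemma bin_ratio (R : realType) (lambda : R) (z j : nat) :
  (z.+1%:R - j%:R) * ('C(z.+1, j)%:R * lambda ^+ (z.+1 - j)) =
  lambda * z.+1%:R * ('C(z, j)%:R * lambda ^+ (z - j)).
Proof.
have [jz|zj] := leqP j z; last first.
  rewrite (bin_small zj) mul0r mulr0.
  have [->|nj] := eqVneq j z.+1; first by rewrite subrr mul0r.
  by rewrite (@bin_small z.+1) ?mul0r ?mulr0 //; lia.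
rewrite -natrB ?(leqW jz) // subSn // exprS.
have := mul_bin_down z.+1 j; rewrite /= subSn // => /(congr1 (fun m => m%:R : R)).
rewrite !natrM => E; transitivity
  (lambda * lambda ^+ (z - j) * (z.+1%:R * 'C(z, j)%:R)); last by ring.
by rewrite E; ring.
Qed.

Lemma Delta_ratio (R : realType) (lambda : R) (z l : nat) :
  (z.+1%:R - l%:R) * Delta lambda z.+1 l =
  lambda * z.+1%:R * Delta lambda z l.
Proof.
rewrite !DeltaE -!mulrA !(mulrCA _ ((1 - lambda) ^+ l.+1)) bin_ratio; ring.
Qed.

(** The binomial weights of index [j <= l] shrink at least as fast, from [z]
    to [z.+1] trials, as the weight of index [l]; this makes [B] over
    [Delta] nonincreasing in [z], and it bounds the ratio of consecutive [B]s
    by a quantity that tends to [lambda] as [z] grows. *)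
Lemma B_ratio_le (R : realType) (lambda : R) (z l : nat) :
  0 <= lambda <= 1 ->
  (z.+1%:R - l%:R) * B lambda z.+1 l <= lambda * z.+1%:R * B lambda z l.
Proof.
move=> lam; have /andP[l0 l1] := lam; rewrite /B !mulr_sumr big_nat_cond.
rewrite [leRHS]big_nat_cond; apply: ler_sum => j /andP[/andP[_ jl] _].
rewrite -!mulrA !(mulrCA _ ((1 - lambda) ^+ j)) ler_wpM2l ?exprn_ge0 ?subr_ge0 //.
rewrite [leRHS]mulrA -bin_ratio ler_wpM2r ?mulr_ge0 ?exprn_ge0 //.
by rewrite lerD2l lerN2 ler_nat.
Qed.

(** A further trial fails with probability [lambda]. *)
Lemma B_ratio_ge (R : realType) (lambda : R) (z l : nat) :
  0 <= lambda <= 1 -> lambda * B lambda z l <= B lambda z.+1 l.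
Proof.
move=> lam; have /andP[l0 l1] := lam.
rewrite /B mulr_sumr ler_sum_nat // => j _.
have [jz|zj] := leqP j z; last first.
  rewrite (bin_small zj) !(mul0r, mulr0).
  by rewrite !mulr_ge0 ?exprn_ge0 ?subr_ge0.
rewrite [leLHS](_ : _ =
    'C(z, j)%:R * (1 - lambda) ^+ j * lambda ^+ (z.+1 - j)); last first.
  by rewrite subSn // exprS; ring.
rewrite !ler_wpM2r ?exprn_ge0 ?subr_ge0 // ler_nat.
by case: (j) => [|i]; rewrite ?bin0 // binS leq_addr.
Qed.

(** Since consecutive values of [B] have ratio tending to [lambda], [B] decays
    at every exponential rate slower than [lambda]. *)
Lemma B_geometric (R : realType) (lambda mu : R) (l : nat) :
  0 < lambda -> lambda < mu < 1 ->
  exists2 C : R, 0 < C & forall z, B lambda z l <= C * mu ^+ z.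
Proof.
move=> lam /andP[lmu mu1]; have lam' : 0 <= lambda <= 1 by lra.
have mu0 : 0 < mu by lra.
pose M := Num.truncn (mu * l%:R / (mu - lambda)).
have step k : B lambda (M + k) l <= mu ^+ k.
  elim: k => [|k IH]; first by rewrite addn0 expr0 B_le1.
  rewrite addnS exprS (le_trans _ (ler_wpM2l (ltW mu0) IH)) //.
  set z := (M + k)%N; have B0 := B_ge0 z l lam'.
  have zM : mu * l%:R < (mu - lambda) * z.+1%:R.
    rewrite [ltRHS]mulrC -ltr_pdivrMr ?subr_gt0 //.
    by rewrite (lt_le_trans (truncnS_gt _)) // ler_nat ltnS leq_addr.
  have z0 : 0 <= lambda * z.+1%:R by rewrite mulr_ge0 ?ltW.
  have zl : lambda * z.+1%:R <= mu * (z.+1%:R - l%:R) by lra.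
  have zl0 : 0 < z.+1%:R - l%:R :> R by rewrite -(pmulr_rgt0 _ mu0); lra.
  rewrite -(ler_pM2l zl0) (le_trans (B_ratio_le z l lam')) //.
  by rewrite mulrA ler_wpM2r // [leRHS]mulrC.
exists (mu ^- M) => [|z]; first by rewrite invr_gt0 exprn_gt0.
rewrite mulrC ler_pdivlMr ?exprn_gt0 //.
have [Mz|/ltnW zM] := leqP M z.
  rewrite -{1}(subnKC Mz) -[in leRHS](subnK Mz) exprD.
  by rewrite ler_wpM2r ?exprn_ge0 // ltW.
rewrite -[leRHS]mul1r ler_pM ?B_ge0 ?B_le1 ?exprn_ge0 ?(ltW mu0) //.
by rewrite ler_wiXn2l ?ltW.
Qed.

(** * Reduction to the number of ones *)

Definition wt (n : nat) (y : Yspace n) : nat := \sum_i y i.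

(** The probability of [L <= l] together with [Y_{n+1} = 1], given that exactly
    [z] of the [n + 1] exchangeable variables are 1: the last one is then 1 with
    probability [z / (n + 1)], leaving [z - 1] ones before it. *)
Definition hitlast (R : realType) (lambda : R) (l n z : nat) : R :=
  z%:R / n.+1%:R * B lambda z.-1 l.

(** The probability of [L <= l] under the same condition: the last variable may
    also be 0, and then all [z] ones come before it. *)
Definition hit (R : realType) (lambda : R) (l n z : nat) : R :=
  hitlast lambda l n z + (1 - z%:R / n.+1%:R) * B lambda z l.

(** Expanding [\prod_i (lambda + (1 - lambda) X)] over the positions with
    [y i = 1] gives the generating polynomial of the number of successes. *)
Lemma sum_kernelE (R : realType) (lambda : R) (l n : nat) (y : 'I_n -> bool) :
  \sum_(u : Uspace n | (\sum_i u i <= l)%N) \prod_i Defs.kernel lambda (y i) (u i) =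
  B lambda (\sum_i y i) l.
Proof.
pose K (i : 'I_n) (b : bool) : {poly R} := Defs.kernel lambda (y i) b *: 'X^b.
have KE : \prod_i \sum_b K i b = \sum_(u : Uspace n) \prod_i K i (u i).
  exact: bigA_distr_bigA.
have KuE (u : Uspace n) : \prod_i K i (u i) =
    (\prod_i Defs.kernel lambda (y i) (u i)) *: 'X^(\sum_i u i).
  by rewrite /K scaler_prod expr_sum.
have Kyi i : \sum_b K i b = (lambda%:P + (1 - lambda) *: 'X) ^+ y i.
  rewrite big_bool /K /Defs.kernel; case: (y i) => /=.
    by rewrite expr1 expr0 alg_polyC addrC.
  by rewrite scale0r expr0 alg_polyC add0r.
have coefE j : ((lambda%:P + (1 - lambda) *: 'X) ^+ (\sum_i y i))`_j =
    'C(\sum_i y i, j)%:R * (1 - lambda) ^+ j * lambda ^+ (\sum_i y i - j).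
  rewrite exprDn coef_sum.
  set m := (\sum_i y i)%N.
  have E (i : nat) : ((lambda%:P ^+ (m - i) * ((1 - lambda) *: 'X) ^+ i) *+
      'C(m, i) : {poly R})`_j = (i == j)%:R *
      ('C(m, i)%:R * (1 - lambda) ^+ i * lambda ^+ (m - i)).
    rewrite coefMn -polyC_exp coefCM exprZn coefZ coefXn eq_sym -mulr_natl; ring.
  under eq_bigr do rewrite E.
  have [jm|mj] := ltnP j m.+1.
    rewrite (bigD1 (Ordinal jm)) //= eqxx mul1r big1 ?addr0 // => i.
    by rewrite -val_eqE /= => /negbTE ->; rewrite mul0r.
  rewrite bin_small // !mul0r big1 // => i _.
  rewrite (_ : (i == j :> nat) = false) ?mul0r //; apply/eqP.
  by have := ltn_ord i; lia.
rewrite /B; under [RHS]eq_bigr do rewrite -coefE.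
have -> : (lambda%:P + (1 - lambda) *: 'X) ^+ (\sum_i y i) =
    \sum_(u : Uspace n)
      (\prod_i Defs.kernel lambda (y i) (u i)) *: 'X^(\sum_i u i) :> {poly R}.
  rewrite expr_sum -(eq_bigr _ (fun u _ => KuE u)) -KE.
  by apply: eq_bigr => i _; rewrite Kyi.
under [RHS]eq_bigr do rewrite coef_sum.
rewrite exchange_big /= big_mkcond; apply: eq_bigr => u _.
under [RHS]eq_bigr do rewrite coefZ coefXn.
rewrite -mulr_sumr; case: leqP => ul.
  rewrite big_mkord (bigD1 (Ordinal (ul : (_ < l.+1)%N))) //= eqxx [X in _ + X]big1.
    by rewrite addr0 mulr1.
  by move=> i; rewrite -val_eqE /= => /negbTE ->.
rewrite [X in _ * X]big1_seq ?mulr0 // => j; rewrite mem_index_iota => /andP[_ /andP[_ jl]].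
by rewrite (_ : (j == _) = false) //; apply/eqP; lia.
Qed.

Lemma sum_joint (R : realType) (lambda : R) (l n : nat) (Q : Yspace n -> R)
    (E : pred (Yspace n)) :
  \sum_(w | E w.1 && L_le l w) joint lambda Q w =
  \sum_(y | E y) Q y * B lambda (wt y - y ord_max) l.
Proof.
rewrite (eq_bigl (fun w => E w.1 && (L (w.1, w.2) <= l)%N)); last by case.
rewrite -(pair_big_dep E (fun y u => (L (y, u) <= l)%N)
  (fun y u => joint lambda Q (y, u))) /=.
apply: eq_bigr => y _; rewrite /joint /= -mulr_sumr; congr (_ * _).
have := sum_kernelE lambda l (fun i => y (widen_ord (leqnSn n) i)).
by rewrite /L /= => ->; rewrite /wt big_ord_recr /= addnK.
Qed.

Lemma wt_le (n : nat) (y : Yspace n) : (wt y <= n.+1)%N.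
Proof.
rewrite -[leqRHS]card_ord -sum1_card; apply: leq_sum => i _; exact: leq_b1.
Qed.

Lemma wt_perm (n : nat) (s : 'S_n.+1) (y : Yspace n) :
  wt [ffun i => y (s i)] = wt y.
Proof.
rewrite /wt [RHS](reindex_inj (@perm_inj _ s)).
by apply: eq_bigr => i _; rewrite ffunE.
Qed.

(** Under an exchangeable law all coordinates have the same expected product with
    a function of the number of ones, so the last coordinate may be replaced by
    the average of all of them. *)
Lemma exchangeable_last (R : realType) (n : nat) (Q : Yspace n -> R)
    (f : nat -> R) : exchangeable Q ->
  \sum_y Q y * f (wt y) * (y ord_max)%:R =
  \sum_y Q y * f (wt y) * ((wt y)%:R / n.+1%:R).
Proof.
move=> exQ.
have same i : \sum_y Q y * f (wt y) * (y i)%:R =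
              \sum_y Q y * f (wt y) * (y ord_max)%:R.
  pose s := tperm i ord_max.
  pose h (y : Yspace n) : Yspace n := [ffun j => y (s j)].
  have hK : involutive h by move=> y; apply/ffunP => j; rewrite !ffunE tpermK.
  rewrite (reindex_inj (inv_inj hK)); apply: eq_bigr => y _.
  by rewrite /h exQ ffunE tpermL wt_perm.
have n0 : n.+1%:R != 0 :> R by rewrite pnatr_eq0.
apply: (mulfI n0); set S := (S in n.+1%:R * S = _).
have -> : n.+1%:R * S = \sum_(i < n.+1) S by rewrite sumr_const card_ord mulr_natl.
rewrite {}/S; under eq_bigr => i _ do rewrite -(same i).
rewrite exchange_big mulr_sumr; apply: eq_bigr => y _ /=.
by rewrite -mulr_sumr -natr_sum -/(wt y) mulrCA [n.+1%:R * _]mulrC divfK.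
Qed.

Lemma Pr_L_le (R : realType) (lambda : R) (l n : nat) (Q : Yspace n -> R) :
  exchangeable Q -> Pr lambda Q (L_le l) = \sum_y Q y * hit lambda l n (wt y).
Proof.
move=> exQ; rewrite /Pr (sum_joint lambda l Q predT) /=.
pose f z := B lambda z.-1 l - B lambda z l.
transitivity (\sum_y (Q y * B lambda (wt y) l +
                      Q y * f (wt y) * (y ord_max)%:R)).
  apply: eq_bigr => y _; rewrite /f.
  by case: (y ord_max); rewrite ?subn1 ?subn0 /= ?mulr0 ?addr0 // mulr1 mulrBr addrC subrK.
rewrite big_split /= exchangeable_last // -big_split; apply: eq_bigr => y _.
by rewrite /f /hit /hitlast /=; ring.
Qed.

Lemma Pr_Ylast_L_le (R : realType) (lambda : R) (l n : nat)
    (Q : Yspace n -> R) : exchangeable Q ->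
  Pr lambda Q (predI Ylast (L_le l)) = \sum_y Q y * hitlast lambda l n (wt y).
Proof.
move=> exQ; rewrite /Pr (sum_joint lambda l Q (fun y => y ord_max)) /=.
transitivity (\sum_y Q y * B lambda (wt y).-1 l * (y ord_max)%:R).
  rewrite [LHS]big_mkcond; apply: eq_bigr => y _.
  by case: (y ord_max); rewrite ?subn1 ?mulr1 ?mulr0.
rewrite (exchangeable_last (fun z => B lambda z.-1 l)) //.
by apply: eq_bigr => y _; rewrite /hitlast; ring.
Qed.

Lemma hitlast_ge0 (R : realType) (lambda : R) (l n z : nat) :
  0 <= lambda <= 1 -> 0 <= hitlast lambda l n z.
Proof. by move=> lam; rewrite mulr_ge0 ?divr_ge0 ?ler0n ?B_ge0. Qed.

Lemma frac_le1 (R : realType) (n z : nat) :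
  (z <= n.+1)%N -> z%:R / n.+1%:R <= 1 :> R.
Proof. by move=> zn; rewrite ler_pdivrMr ?ltr0n // mul1r ler_nat. Qed.

Lemma hitlast_le_hit (R : realType) (lambda : R) (l n z : nat) :
  0 <= lambda <= 1 -> (z <= n.+1)%N -> hitlast lambda l n z <= hit lambda l n z.
Proof.
by move=> lam zn; rewrite lerDl mulr_ge0 ?B_ge0 // subr_ge0 frac_le1.
Qed.

Lemma hitE (R : realType) (lambda : R) (l n z : nat) :
  hit lambda l n z =
  B lambda z l + z%:R / n.+1%:R * (B lambda z.-1 l - B lambda z l).
Proof. by rewrite /hit /hitlast; ring. Qed.

Lemma B_le_hit (R : realType) (lambda : R) (l n z : nat) :
  0 <= lambda <= 1 -> B lambda z l <= hit lambda l n z.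
Proof.
move=> lam; rewrite hitE lerDl mulr_ge0 ?divr_ge0 ?ler0n // subr_ge0.
exact: B_nonincreasing (leq_pred z).
Qed.

(** The uniform laws on the configurations with a given number of ones are the
    extreme points of the exchangeable laws. Since there is a single
    constraint, mixtures of two of them reach the optimum. *)
Definition levels (R : realType) (n : nat) (p : R) (z z' : nat)
    (y : Yspace n) : R :=
  p * (wt y == z)%:R / #|[pred x : Yspace n | wt x == z]|%:R +
  (1 - p) * (wt y == z')%:R / #|[pred x : Yspace n | wt x == z']|%:R.

Lemma level_nonempty (n z : nat) : (z <= n.+1)%N ->
  (0 < #|[pred x : Yspace n | wt x == z]|)%N.
Proof.
move=> zn; apply/card_gt0P; exists [ffun i : 'I_n.+1 => (i < z)%N].
rewrite inE /wt; under eq_bigr do rewrite ffunE.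
apply/eqP; rewrite -[RHS]card_ord -sum1_card (big_ord_widen _ (fun=> 1%N) zn).
by rewrite [RHS]big_mkcond; apply: eq_bigr => i _; case: ltnP.
Qed.

Lemma sum_level (R : realType) (n z : nat) (F : nat -> R) : (z <= n.+1)%N ->
  \sum_(y : Yspace n)
    (wt y == z)%:R / #|[pred x : Yspace n | wt x == z]|%:R * F (wt y) = F z.
Proof.
move=> zn; transitivity (\sum_(y in [pred x : Yspace n | wt x == z])
    F z / #|[pred x : Yspace n | wt x == z]|%:R).
  rewrite [RHS]big_mkcond; apply: eq_bigr => y _; rewrite inE.
  by case: eqP => [->|_]; rewrite ?mul1r ?mul0r // mulrC.
rewrite sumr_const -[LHS]mulr_natr divfK //.
by rewrite pnatr_eq0 -lt0n level_nonempty.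
Qed.

Lemma sum_levels (R : realType) (n z z' : nat) (p : R) (F : nat -> R) :
  (z <= n.+1)%N -> (z' <= n.+1)%N ->
  \sum_(y : Yspace n) levels p z z' y * F (wt y) = p * F z + (1 - p) * F z'.
Proof.
move=> zn zn'; rewrite -[in RHS](sum_level F zn) -[in RHS](sum_level F zn').
rewrite !mulr_sumr -big_split; apply: eq_bigr => y _ /=.
by rewrite /levels mulrDl !mulrA.
Qed.

Lemma levels_distribution (R : realType) (n z z' : nat) (p : R) :
  0 <= p <= 1 -> (z <= n.+1)%N -> (z' <= n.+1)%N ->
  Defs.distribution (@levels R n p z z').
Proof.
move=> /andP[p0 p1] zn zn'; split => [y|].
  by rewrite addr_ge0 ?mulr_ge0 ?invr_ge0 ?ler0n ?subr_ge0.
have := sum_levels p (fun=> 1) zn zn'.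
by under eq_bigr do rewrite mulr1; move=> ->; rewrite !mulr1 addrC subrK.
Qed.

Lemma levels_exchangeable (R : realType) (n z z' : nat) (p : R) :
  exchangeable (@levels R n p z z').
Proof. by move=> s y; rewrite /levels wt_perm. Qed.

(** * Existence of the maximum and bounds on it *)

Definition feasible (R : realType) (lambda : R) (l n : nat) (delta : R)
    (Q : Yspace n -> R) :=
  [/\ Defs.distribution Q, exchangeable Q & delta <= Pr lambda Q (L_le l)].

(** The all-zero configuration makes [L <= l] certain. *)
Lemma feasible_nonempty (R : realType) (lambda : R) (l n : nat) (delta : R) :
  0 <= lambda <= 1 -> delta <= 1 ->
  exists Q : Yspace n -> R, feasible lambda l delta Q.
Proof.
move=> lam d1; exists (@levels R n 1 0 0); split.
- by apply: levels_distribution => //; rewrite ler01 lexx.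
- exact: levels_exchangeable.
- rewrite Pr_L_le; last exact: levels_exchangeable.
  rewrite sum_levels // subrr mul0r addr0 mul1r (le_trans d1) //.
  by rewrite -(B_le1E lambda (leq0n l)) B_le_hit.
Qed.

Lemma linear_form_continuous (R : realType) (m : nat) (I : finType)
    (P : pred I) (c : I -> R) (f : I -> 'I_m) :
  continuous (fun v : 'rV[R]_m => \sum_(i | P i) v ord0 (f i) * c i).
Proof.
move=> v; apply: (cvg_big add_continuous (nbhs_filter v)) => i _.
apply: (@cvgM _ _ _ (nbhs_filter v)); [exact: coord_continuous | exact: cvg_cst].
Qed.

(** The feasible laws form a compact set on which the conditional probability
    is continuous, its denominator being at least [delta]; hence the maximum
    defining [eps] exists and the default value of [set_max] is never taken. *)
Lemma eps_attained (R : realType) (lambda : R) (l n : nat) (delta : R) :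
  0 <= lambda <= 1 -> 0 < delta <= 1 ->
  exists2 Q : Yspace n -> R, feasible lambda l delta Q &
    forall Q' : Yspace n -> R, feasible lambda l delta Q' ->
      condPr lambda Q' Ylast (L_le l) <= condPr lambda Q Ylast (L_le l).
Proof.
move=> lam /andP[d0 d1].
pose m := #|Yspace n|.
pose law (v : 'rV[R]_m) (y : Yspace n) : R := v ord0 (enum_rank y).
pose A := [set v | feasible lambda l delta (law v)].
pose vec (Q : Yspace n -> R) : 'rV[R]_m := \row_i Q (enum_val i).
have vecK Q : law (vec Q) = Q by apply/funext => y; rewrite /law mxE enum_rankK.
have Pr_cont E : continuous (fun v => Pr lambda (law v) E).
  by move=> v; apply: linear_form_continuous.
have law_cont y : continuous (law ^~ y) by move=> v; exact: coord_continuous.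
have sum_cont : continuous (fun v => \sum_y law v y).
  have -> : (fun v => \sum_y law v y) = (fun v => \sum_y law v y * 1).
    by apply/funext => v; apply: eq_bigr => y _; rewrite mulr1.
  exact: linear_form_continuous.
have cpre (f : 'rV[R]_m -> R) (D : set R) : continuous f -> closed D ->
    closed (f @^-1` D).
  by move=> cf cD; apply: preimage_closed => // v _; exact: cf.
have clA : closed A.
  have -> : A = (\bigcap_y ((law ^~ y) @^-1` [set x | 0 <= x])) `&`
     ((fun v => \sum_y law v y) @^-1` [set x | x = 1]) `&`
     (\bigcap_(sy : 'S_n.+1 * Yspace n)
        ((fun v => law v [ffun i => sy.2 (sy.1 i)] - law v sy.2)
          @^-1` [set x | x = 0])) `&`
     ((fun v => Pr lambda (law v) (L_le l)) @^-1` [set x | delta <= x]).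
    apply/seteqP; split => v.
      move=> [[pos sum1] exch dPr]; split => //; split; last first.
        by move=> [s y] _ /=; rewrite exch subrr.
      by split => // y _; exact: pos.
    move=> [[[pos sum1] exch] dPr]; split => //.
      by split => // y; exact: (pos y I).
    by move=> s y; apply/eqP; rewrite -subr_eq0; apply/eqP/(exch (s, y) I).
  apply: closedI; [apply: closedI; [apply: closedI|]|].
  - by apply: closed_bigI => y _; apply: cpre => //; exact: closed_ge.
  - by apply: cpre => //; exact: closed_eq.
  - apply: closed_bigI => -[s y] _; apply: cpre; last exact: closed_eq.
    move=> v; apply: (@cvgB _ _ _ _ (nbhs_filter v)).
      exact: (law_cont [ffun i => y (s i)] v).
    exact: (law_cont y v).
  - by apply: cpre => //; exact: closed_ge.
have cptA : compact A.
  apply: (subclosed_compact clA (@rV_compact R m (fun=> `[0, 1]%classic) _)).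
    by move=> _; exact: segment_compact.
  move=> v [[pos sum1] _ _] i /=; rewrite in_itv /= -(enum_valK i).
  rewrite (pos (enum_val i)) /= -sum1 (bigD1 (enum_val i)) //= lerDl.
  by apply: sumr_ge0 => y _; exact: pos.
have A0 : A !=set0.
  have [Q fQ] := feasible_nonempty l n lam d1.
  by exists (vec Q); rewrite /A /= vecK.
have cont : {within A, continuous
    (fun v => condPr lambda (law v) Ylast (L_le l))}.
  apply: continuous_in_subspaceT => v; rewrite inE => -[_ _ dPr].
  apply: (@cvgM _ _ _ (nbhs_filter v)); first exact: (Pr_cont _ v).
  apply: (@cvgV _ _ _ (nbhs_filter v)); last exact: (Pr_cont _ v).
  by rewrite gt_eqF // (lt_le_trans d0).
have [v vA vmax] := compact_EVT_max A0 cptA cont.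
exists (law v); first by move: vA; rewrite inE.
by move=> Q' fQ'; rewrite -[Q']vecK; apply: vmax; rewrite inE /A /= vecK.
Qed.

Lemma eps_max (R : realType) (lambda : R) (l n : nat) (delta : R) :
  0 <= lambda <= 1 -> 0 < delta <= 1 ->
  (exists2 Q : Yspace n -> R, feasible lambda l delta Q &
     eps lambda l n delta = condPr lambda Q Ylast (L_le l)) /\
  forall Q : Yspace n -> R, feasible lambda l delta Q ->
    condPr lambda Q Ylast (L_le l) <= eps lambda l n delta.
Proof.
move=> lam d01; have [Q0 fQ0 maxQ0] := eps_attained l n lam d01.
rewrite /eps /set_max; set S := (X in X `&` _).
have [[Q fQ <-] ub] : (S `&` ubound S) (xget 0 (S `&` ubound S)).
  apply: xgetPex; exists (condPr lambda Q0 Ylast (L_le l)); split.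
    by exists Q0.
  by move=> _ [Q fQ <-]; exact: maxQ0.
split; first by exists Q.
by move=> Q' fQ'; apply: ub; exists Q'.
Qed.

(** Upper bounds for [eps] are tested on every [z] separately, because both
    probabilities are averages over the number [z] of ones. *)
Lemma eps_le_of_levels (R : realType) (lambda : R) (l n : nat)
    (delta v c : R) : 0 <= lambda <= 1 -> 0 < delta <= 1 -> 0 <= c ->
  (forall z, (z <= n.+1)%N ->
     hitlast lambda l n z <= v * hit lambda l n z + c * delta) ->
  eps lambda l n delta <= v + c.
Proof.
move=> lam d01 c0 zle; have /andP[d0 d1] := d01.
have [[Q [[Q0 Q1] exQ dPr] ->] _] := eps_max l n lam d01.
have P0 : 0 < Pr lambda Q (L_le l) by rewrite (lt_le_trans d0).
rewrite /condPr ler_pdivrMr // mulrDl.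
apply: (@le_trans _ _ (v * Pr lambda Q (L_le l) + c * delta)); last first.
  by rewrite lerD2l ler_wpM2l.
rewrite Pr_Ylast_L_le // Pr_L_le // -[c * delta]mulr1 -Q1 !mulr_sumr -big_split.
apply: ler_sum => y _ /=.
by rewrite [v * _]mulrCA [c * delta * _]mulrC -mulrDr ler_wpM2l // zle ?wt_le.
Qed.

Lemma eps_ge_levels (R : realType) (lambda : R) (l n z z' : nat)
    (p delta : R) : 0 <= lambda <= 1 -> 0 < delta <= 1 -> 0 <= p <= 1 ->
  (z <= n.+1)%N -> (z' <= n.+1)%N ->
  delta <= p * hit lambda l n z + (1 - p) * hit lambda l n z' ->
  (p * hitlast lambda l n z + (1 - p) * hitlast lambda l n z') /
  (p * hit lambda l n z + (1 - p) * hit lambda l n z') <= eps lambda l n delta.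
Proof.
move=> lam d01 p01 zn zn' dh; have [_] := eps_max l n lam d01.
have ex := @levels_exchangeable R n z z' p.
move=> /(_ (levels p z z')); rewrite /condPr Pr_Ylast_L_le // Pr_L_le //.
rewrite !sum_levels //; apply; split => //; first exact: levels_distribution.
by rewrite Pr_L_le // sum_levels.
Qed.

Lemma eps_ge_level (R : realType) (lambda : R) (l n z : nat) (delta : R) :
  0 <= lambda <= 1 -> 0 < delta <= 1 -> (z <= n.+1)%N ->
  delta <= hit lambda l n z ->
  hitlast lambda l n z / hit lambda l n z <= eps lambda l n delta.
Proof.
move=> lam d01 zn dh.
have := @eps_ge_levels R lambda l n z z 1 delta lam d01.
by rewrite !subrr !mul0r !mul1r !addr0; apply => //; rewrite ler01 lexx.
Qed.

Lemma eps_le1 (R : realType) (lambda : R) (l n : nat) (delta : R) :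
  0 <= lambda <= 1 -> 0 < delta <= 1 -> eps lambda l n delta <= 1.
Proof.
move=> lam d01; rewrite -[1]addr0; apply: eps_le_of_levels => // z zn.
by rewrite mul1r mul0r addr0 hitlast_le_hit.
Qed.

(** * First-order expansion at a fixed level *)

(** The natural expansion variable of the model is [1 / (n + 1)]; replacing it
    by [1 / n] costs [O(n^-2)], like the error itself. *)
Lemma first_order_expansion (R : realType) (u : nat -> R) (g C : R) :
  (\forall n \near \oo, `|u n - g * n.+1%:R^-1| <= C * n.+1%:R^-1 ^+ 2) ->
  u = (fun n => g * n%:R^-1) +o_\oo (fun n => n%:R^-1 : R).
Proof.
move=> uC; apply/eqaddoP => e e0.
near=> n.
have n0 : 0 < n%:R :> R by rewrite ltr0n; near: n; exact: nbhs_infty_gt.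
have Cn : `|C| + `|g| <= e * n%:R.
  rewrite mulrC -ler_pdivrMr //; near: n; exact: nbhs_infty_ger.
have un : `|u n - g * n.+1%:R^-1| <= C * n.+1%:R^-1 ^+ 2 by near: n.
set x : R := n%:R^-1; set y : R := n.+1%:R^-1.
have x0 : 0 < x by rewrite invr_gt0.
have y0 : 0 < y by rewrite invr_gt0.
have yx : y <= x by rewrite lef_pV2 ?posrE // ler_nat.
have xy : x - y = x * y.
  by rewrite /x /y -natr1; field; rewrite natr1 pnatr_eq0 /= gt_eqF.
rewrite /= [`|x|]gtr0_norm //.
have -> : (u - (fun n => g * n%:R^-1)) n = (u n - g * y) - g * (x * y).
  by rewrite -xy mulrBr opprB addrA addrNK.
rewrite (le_trans (ler_normB _ _)) // (le_trans (lerD un (lexx _))) //.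
have xx : x * y <= x ^+ 2 by rewrite expr2 ler_wpM2l // ltW.
have yy : y ^+ 2 <= x ^+ 2 by rewrite ler_pXn2r // nnegrE ltW.
apply: (@le_trans _ _ ((`|C| + `|g|) * x ^+ 2)).
  rewrite mulrDl lerD //.
    by rewrite (le_trans (ler_wpM2r _ (ler_norm _))) ?ler_wpM2l ?exprn_ge0 // ltW.
  by rewrite normrM [`|x * y|]gtr0_norm ?mulr_gt0 // ler_wpM2l.
apply: le_trans (ler_wpM2r (exprn_ge0 2 (ltW x0)) Cn) _.
by rewrite expr2 -!mulrA mulVKf // gt_eqF.
Unshelve. all: by end_near. Qed.

(** As [n] grows, [(hit z, n * hitlast z)] tends to [(B z, z * B z.-1)].  If
    all these limit points lie below a line, and the points of [z] and [z.+1]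
    lie on it, on either side of the abscissa [delta], then the optimum is
    asymptotically the ordinate of the line at [delta], divided by [delta].
    The same line gives the upper bound and the mixture of the two levels the
    lower one, both up to an error of order [n ^ -2]. *)
Lemma eps_expansion (R : realType) (lambda : R) (l z : nat)
    (delta A T p : R) :
  0 <= lambda <= 1 -> 0 < delta <= 1 -> 0 <= A ->
  (forall y, y%:R * B lambda y.-1 l <= A - T * B lambda y l) ->
  z%:R * B lambda z.-1 l = A - T * B lambda z l ->
  z.+1%:R * B lambda z l = A - T * B lambda z.+1 l ->
  0 <= p <= 1 -> p * B lambda z l + (1 - p) * B lambda z.+1 l = delta ->
  (fun n : nat => eps lambda l n delta)
    = (fun n : nat => (A / delta - T) * n%:R^-1) +o_\oo (fun n => n%:R^-1 : R).
Proof.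
move=> lam d01 A0 below onz onz1 p01 pdelta; have /andP[d0 d1] := d01.
have /andP[p0 p1] := p01.
(* [hit z - B z] is [gap z / (n + 1)]; the line itself bounds the gap
   uniformly in [z], because [B] lies between 0 and 1. *)
set K := A + `|T|; have K0 : 0 <= K by rewrite addr_ge0.
have gap y : 0 <= y%:R * (B lambda y.-1 l - B lambda y l) <= K.
  have B0 := B_ge0 y l lam; have B1 := B_le1 y l lam.
  rewrite mulr_ge0 ?subr_ge0 ?(B_nonincreasing _ lam) ?leq_pred //=.
  apply: (@le_trans _ _ (y%:R * B lambda y.-1 l)).
    by rewrite ler_wpM2l // gerBl.
  rewrite (le_trans (below y)) // lerD2l -mulNr.
  apply: (@le_trans _ _ (`|T| * B lambda y l)); last by rewrite ler_piMr.
  by rewrite ler_wpM2r // -normrN ler_norm.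
set D := A - T * delta.
have DE : p * (z%:R * B lambda z.-1 l) + (1 - p) * (z.+1%:R * B lambda z l) = D.
  by rewrite onz onz1 /D -pdelta; ring.
have D0 : 0 <= D by rewrite -DE addr_ge0 ?mulr_ge0 ?subr_ge0 ?B_ge0 ?ler0n.
apply: (@first_order_expansion _ _ _
  (`|T| * K / delta + D * K / delta ^+ 2)).
near=> n.
have zn : (z < n.+1)%N by rewrite ltnS; near: n; exact: nbhs_infty_ge.
set x : R := n.+1%:R^-1; have x0 : 0 <= x by rewrite invr_ge0.
have lastE y : hitlast lambda l n y = x * (y%:R * B lambda y.-1 l).
  by rewrite /hitlast -/x; ring.
have hE y : hit lambda l n y =
    B lambda y l + x * (y%:R * (B lambda y.-1 l - B lambda y l)).
  by rewrite hitE -/x; ring.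
have err1 : 0 <= `|T| * K / delta * x ^+ 2.
  by rewrite !mulr_ge0 ?exprn_ge0 ?invr_ge0 // ltW.
have err2 : 0 <= D * K / delta ^+ 2 * x ^+ 2.
  by rewrite !mulr_ge0 ?exprn_ge0 ?invr_ge0 ?exprn_ge0 // ltW.
have upper : eps lambda l n delta <= - (T * x) +
    x * (A + `|T| * K * x) / delta.
  apply: eps_le_of_levels => // [|y yn].
    by rewrite !mulr_ge0 ?addr_ge0 ?mulr_ge0 ?invr_ge0 // ltW.
  rewrite divfK ?gt_eqF // lastE hE mulrDr.
  have /andP[gap0 gapK] := gap y.
  have := below y; have : T * (y%:R * (B lambda y.-1 l - B lambda y l)) <= `|T| * K.
    by rewrite (le_trans (ler_wpM2r gap0 (ler_norm T))) // ler_wpM2l.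
  set a := y%:R * (_ - _) => Ta; set b := B lambda y l.
  set c := y%:R * _ => cA.
  have cx : x * c <= x * (A - T * b) by rewrite ler_wpM2l.
  have ax : x * x * (T * a) <= x * x * (`|T| * K).
    by rewrite ler_wpM2l // mulr_ge0.
  lra.
have lower : D * x * (delta^-1 - K * x / delta ^+ 2) <= eps lambda l n delta.
  set H := p * hit lambda l n z + (1 - p) * hit lambda l n z.+1.
  pose a y := y%:R * (B lambda y.-1 l - B lambda y l).
  have HE : H = delta + x * (p * a z + (1 - p) * a z.+1).
    by rewrite /H !hE -pdelta /a; ring.
  have /andP[z0 zK] := gap z; have /andP[z10 z1K] := gap z.+1.
  have dH : delta <= H.
    by rewrite HE lerDl mulr_ge0 // addr_ge0 // mulr_ge0 // subr_ge0.
  have HK : H <= delta + x * K.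
    rewrite HE lerD2l ler_wpM2l //.
    have -> : K = p * K + (1 - p) * K by ring.
    by rewrite lerD // ler_wpM2l // subr_ge0.
  apply: le_trans _ (eps_ge_levels lam d01 p01 (ltnW zn) zn dH).
  rewrite !lastE -/H.
  have -> : p * (x * (z%:R * B lambda z.-1 l)) +
      (1 - p) * (x * (z.+1%:R * B lambda z.+1.-1 l)) = D * x.
    by rewrite -DE /=; ring.
  have H0 : 0 < H by rewrite (lt_le_trans d0).
  rewrite ler_wpM2l ?mulr_ge0 // -(ler_pM2r H0) mulVf ?gt_eqF //.
  have -> : delta^-1 - K * x / delta ^+ 2 = (delta - K * x) / delta ^+ 2.
    by field; rewrite gt_eqF.
  rewrite mulrAC ler_pdivrMr ?exprn_gt0 // mul1r.
  have Kx : 0 <= K * x by rewrite mulr_ge0.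
  have [neg|pos] := leP (delta - K * x) 0.
    apply: (@le_trans _ _ 0); last by rewrite exprn_ge0 // ltW.
    by rewrite mulr_le0_ge0 // ltW.
  apply: le_trans (ler_wpM2l (ltW pos) HK) _.
  by rewrite [x * K]mulrC -subr_sqr lerBlDr lerDl sqr_ge0.
have upE : - (T * x) + x * (A + `|T| * K * x) / delta =
    (A / delta - T) * x + `|T| * K / delta * x ^+ 2.
  by field; rewrite gt_eqF.
have loE : D * x * (delta^-1 - K * x / delta ^+ 2) =
    (A / delta - T) * x - D * K / delta ^+ 2 * x ^+ 2.
  by rewrite /D; field; rewrite gt_eqF.
by rewrite ler_norml; lra.
Unshelve. all: by end_near. Qed.

(** For [z < l] the left-hand side vanishes. Otherwise both sides are compared
    after multiplication by [z + 1 - l], where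
    [B_ratio_le] and its equality case [Delta_ratio] give the same factor. *)
Lemma B_over_Delta (R : realType) (lambda : R) (z l : nat) :
  0 < lambda < 1 ->
  B lambda z.+1 l * Delta lambda z l <= B lambda z l * Delta lambda z.+1 l.
Proof.
move=> lam; have lam' : 0 <= lambda <= 1 by lra.
have [zl|lz] := ltnP z l.
  by rewrite [Delta _ z _]DeltaE bin_small // !(mul0r, mulr0) mulr_ge0 ?B_ge0 ?Delta_ge0.
have k0 : 0 < z.+1%:R - l%:R :> R by rewrite subr_gt0 ltr_nat.
have E : (z.+1%:R - l%:R) * (B lambda z l * Delta lambda z.+1 l) =
    lambda * z.+1%:R * B lambda z l * Delta lambda z l.
  by rewrite mulrCA Delta_ratio; ring.
by rewrite -(ler_pM2l k0) E mulrA ler_wpM2r ?Delta_ge0 // B_ratio_le.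
Qed.

Lemma B_log_concave (R : realType) (lambda : R) (z l : nat) :
  0 < lambda < 1 ->
  B lambda z l * B lambda z.+2 l <= B lambda z.+1 l ^+ 2.
Proof. by move=> lam; have := B_over_Delta z l lam; rewrite /Delta; lra. Qed.

(** Minus the slope of the segment joining the limit points
    [(B z, z * B z.-1)] of the levels [z] and [z.+1]. *)
Definition slope (R : realType) (lambda : R) (l z : nat) : R :=
  (z.+1%:R * B lambda z l - z%:R * B lambda z.-1 l) / Delta lambda z l.

(** The increments of [z * B z.-1] are [B z - (z - l) / lambda * Delta z], so
    the slope is the sum of [B / Delta] and of a decreasing linear function. *)
Lemma slopeE (R : realType) (lambda : R) (l z : nat) :
  0 < lambda < 1 -> (l <= z)%N ->
  slope lambda l z = B lambda z l / Delta lambda z l - (z%:R - l%:R) / lambda.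
Proof.
move=> lam lz; have D0 := Delta_gt0 lam lz; have l0 : 0 < lambda by lra.
have E : lambda * (z%:R * (B lambda z.-1 l - B lambda z l)) =
    (z%:R - l%:R) * Delta lambda z l.
  case: z lz {D0} => [|z] lz; last by rewrite Delta_ratio /= /Delta; ring.
  have -> : l = 0%N by lia.
  by rewrite /=; ring.
rewrite /slope; apply: (mulIf (lt0r_neq0 D0)); rewrite divfK ?gt_eqF //.
rewrite mulrBl divfK ?gt_eqF //.
by rewrite mulrAC -E [lambda * _]mulrC mulfK ?gt_eqF // -natr1; ring.
Qed.

Lemma slope_nonincreasing (R : realType) (lambda : R) (l z z' : nat) :
  0 < lambda < 1 -> (l <= z <= z')%N -> slope lambda l z' <= slope lambda l z.
Proof.
move=> lam /andP[lz /subnK <-]; elim: (z' - z)%N => [//|k IH].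
apply: le_trans IH; rewrite addSn; set y := (k + z)%N.
have ly : (l <= y)%N by rewrite (leq_trans lz) // leq_addl.
have D0 := Delta_gt0 lam ly; have D1 := Delta_gt0 lam (leqW ly).
rewrite !slopeE ?(leqW ly) //; apply: lerD.
  by rewrite ler_pdivrMr // mulrAC ler_pdivlMr // B_over_Delta.
by rewrite lerN2 ler_pM2r ?invr_gt0 ?lerD2r ?ler_nat //; lra.
Qed.

(** Concavity of the sequence of limit points: the line through two
    consecutive ones dominates them all. *)
Lemma hull_max (R : realType) (lambda : R) (l z y : nat) :
  0 < lambda < 1 -> (l <= z)%N ->
  y%:R * B lambda y.-1 l + slope lambda l z * B lambda y l <=
  z%:R * B lambda z.-1 l + slope lambda l z * B lambda z l.
Proof.
move=> lam lz; set T := slope lambda l z.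
pose F y := y%:R * B lambda y.-1 l + T * B lambda y l.
rewrite -/(F y) -/(F z).
have step x : (l <= x)%N ->
    F x.+1 - F x = (slope lambda l x - T) * Delta lambda x l.
  move=> lx; rewrite mulrBl divfK ?gt_eqF ?Delta_gt0 //.
  by rewrite /F /Delta /=; ring.
have [yz|/ltnW zy] := leqP y z.
  move: yz => /subnK; move: (z - y)%N => k; elim: k y => [|k IH] x; first by rewrite add0n => ->.
  rewrite addSnnS => xz; apply: le_trans (IH _ xz); rewrite -subr_ge0.
  have [xl|lx] := ltnP x l.
    rewrite /F /= !(B_le1E lambda) ?(ltnW xl) //; last by lia.
    by rewrite -natr1; lra.
  rewrite step // mulr_ge0 ?Delta_ge0 //; last by lra.
  by rewrite subr_ge0 slope_nonincreasing // lx -xz; lia.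
move: zy => /subnK <-; elim: (y - z)%N => [//|k IH].
apply: le_trans _ IH; rewrite addSn -subr_le0 step; last by lia.
rewrite mulr_le0_ge0 ?Delta_ge0 //; last by lra.
by rewrite subr_le0 slope_nonincreasing // lz leq_addl.
Qed.

Lemma set_min_natP (P : nat -> Prop) : (exists z, P z) ->
  P (set_min 0%N [set z | P z]) /\
  forall z, P z -> (set_min 0%N [set z | P z] <= z)%N.
Proof.
move=> [z0 Pz0].
have ex : exists z, `[< P z >] by exists z0; apply/asboolP.
have /xgetPex : exists z, ([set z | P z] `&` lbound [set z | P z]) z.
  case: (ex_minnP ex) => z /asboolP Pz zmin; exists z; split => // y Py.
  by rewrite leEnat; apply: zmin; apply/asboolP.
by move=> /(_ 0%N)[].
Qed.

(** The set defining [zup] is nonempty because [B] tends to 0, and its minimum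
    exceeds [l] because [B] equals 1 up to [l]. *)
Lemma zupP (R : realType) (lambda delta : R) (l : nat) :
  0 < lambda < 1 -> 0 < delta < 1 ->
  let zd := zdn l delta lambda in
  [/\ (l <= zd)%N, zup l delta lambda = zd.+1,
      delta < B lambda zd l & B lambda zd.+1 l <= delta].
Proof.
move=> lam del.
have [] := @set_min_natP (fun z => (l <= z)%N /\ B lambda z l <= delta).
  have l0 : 0 < lambda by lra.
  have mu1 : lambda < (lambda + 1) / 2 < 1 by lra.
  have [C C0 BC] := B_geometric l l0 mu1; set mu := (lambda + 1) / 2 in BC.
  have : \forall z \near \oo, (l <= z)%N /\ `|mu ^+ z| < delta / C.
    near=> z; split; first by near: z; exact: nbhs_infty_ge.
    near: z; have /cvgr0Pnorm_lt : mu ^+ z @[z --> \oo] --> 0.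
      by apply: cvg_expr; rewrite ger0_norm /mu; lra.
    by apply; rewrite divr_gt0 //; lra.
  case => z _ /(_ z (leqnn z)) [lz zmu]; exists z; split => //.
  rewrite (le_trans (BC z)) // mulrC -ler_pdivlMr // ltW //.
  exact: le_lt_trans (ler_norm _) zmu.
rewrite -/(zup l delta lambda) /zdn.
case: (zup l delta lambda) => [|z] /= [lz Bz] zmin.
  by move: Bz; rewrite B_le1E //; lra.
have lz' : (l <= z)%N.
  rewrite leqNgt; apply/negP => zl.
  by have := B_le1E lambda (zl : (z.+1 <= l)%N); lra.
split => //; rewrite ltNge; apply/negP => Bd.
by have := zmin z (conj lz' Bd); rewrite ltnn.
Unshelve. all: by end_near. Qed.

(** The levels [zdn] and [zup] enclose [delta], so the line through their limit
    points is the one to use in [eps_expansion]; [G] is its value at [delta]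
    divided by [delta]. *)
Lemma eps_first_order (R : realType) (lambda delta : R) (l : nat) :
  0 < lambda < 1 -> 0 < delta < 1 ->
  (fun n : nat => eps lambda l n delta)
    = (fun n : nat => G l delta lambda * n%:R^-1) +o_\oo (fun n => n%:R^-1 : R).
Proof.
move=> lam del; have lam' : 0 <= lambda <= 1 by lra.
have [lz zuE Bzd Bzu] := zupP l lam del.
rewrite /G zuE /=; move: (zdn l delta lambda) lz Bzd Bzu {zuE} => z lz Bzd Bzu.
set T := slope lambda l z; set A := z%:R * B lambda z.-1 l + T * B lambda z l.
have D0 := Delta_gt0 lam lz.
have TD : T * Delta lambda z l =
    z.+1%:R * B lambda z l - z%:R * B lambda z.-1 l.
  by rewrite divfK // gt_eqF.
have A0 : 0 <= A.
  (* Log-concavity of [B] makes the intercept of the line nonnegative. *)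
  rewrite -(pmulr_lge0 _ D0).
  have -> : A * Delta lambda z l =
      B lambda z l ^+ 2 + z%:R *
      (B lambda z l ^+ 2 - B lambda z.-1 l * B lambda z.+1 l).
    rewrite mulrDl [T * _ * _]mulrAC TD -natr1 /Delta; ring.
  rewrite addr_ge0 ?sqr_ge0 // mulr_ge0 // subr_ge0.
  case: (z) => [|y] /=; last exact: B_log_concave.
  by rewrite expr2 ler_wpM2l ?B_ge0 // B_nonincreasing.
pose p := (delta - B lambda z.+1 l) / Delta lambda z l.
have DE : B lambda z.+1 l = B lambda z l - Delta lambda z l.
  by rewrite /Delta; ring.
have -> : ((B lambda z l - delta) * (z.+1%:R * B lambda z l) +
    (delta - B lambda z.+1 l) * (z%:R * B lambda z.-1 l)) /
    (delta * Delta lambda z l) = A / delta - T.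
  have d0 : delta != 0 by rewrite gt_eqF //; lra.
  have XE : (A / delta - T) * (delta * Delta lambda z l) =
      A * Delta lambda z l - delta * (T * Delta lambda z l).
    by field.
  apply: (mulIf (mulf_neq0 d0 (lt0r_neq0 D0))).
  rewrite XE divfK ?mulf_neq0 ?(lt0r_neq0 D0) //.
  have -> : A * Delta lambda z l = z%:R * B lambda z.-1 l * Delta lambda z l +
     (T * Delta lambda z l) * B lambda z l by rewrite /A; ring.
  by rewrite TD DE; ring.
apply: (@eps_expansion _ _ _ z delta A T p) => //.
- by lra.
- by move=> y; rewrite lerBrDr hull_max.
- by rewrite /A addrK.
- by rewrite DE mulrBr TD /A; ring.
- apply/andP; split; first by rewrite divr_ge0 ?(ltW D0) // subr_ge0.
  by rewrite /p ler_pdivrMr // mul1r /Delta lerD2r ltW.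
- have pD : p * Delta lambda z l = delta - B lambda z.+1 l.
    by rewrite divfK // gt_eqF.
  by rewrite [in RHS](_ : delta = p * Delta lambda z l + B lambda z.+1 l);
     [rewrite /Delta; ring | rewrite pD; ring].
Qed.

Lemma B_lambda0 (R : realType) (z l : nat) :
  B (0 : R) z l = (z <= l)%N%:R.
Proof.
have [zl|lz] := leqP z l; first exact: B_le1E.
rewrite /B big_nat_cond big1 // => j /andP[/andP[_ jl] _].
by rewrite expr0n subn_eq0 leqNgt (leq_trans _ lz) // mulr0.
Qed.

(** Here [B] is the indicator of [z <= k], and the line goes through the limit
    points [(1, k)] and [(0, k + 1)] of the levels [k] and [k + 1]. *)
Lemma eps0_first_order (R : realType) (delta : R) (k : nat) :
  0 < delta < 1 ->
  (fun n : nat => eps 0 k n delta)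
    = (fun n : nat => (k%:R + 1 - delta) / delta * n%:R^-1)
    +o_\oo (fun n => n%:R^-1 : R).
Proof.
move=> del; have d0 : delta != 0 by rewrite gt_eqF //; lra.
have -> : (k%:R + 1 - delta) / delta = k.+1%:R / delta - 1.
  by rewrite natr1 mulrBl divff.
have lam : 0 <= (0 : R) <= 1 by rewrite lexx ler01.
apply: (@eps_expansion _ _ _ k _ _ _ delta) => //.
- by lra.
- move=> y; rewrite !B_lambda0 mul1r; have [yk|ky] := leqP y k.
    rewrite (leq_trans (leq_pred y) yk) mulr1 -natr1 addrK ler_nat //.
  rewrite subr0; have [yk|_] := leqP y.-1 k; last by rewrite mulr0.
  by rewrite mulr1 ler_nat; lia.
- by rewrite !B_lambda0 leqnn leq_pred !mulr1 -natr1 addrK.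
- by rewrite !B_lambda0 leqnn ltnn mulr1 mulr0 subr0.
- by lra.
- by rewrite !B_lambda0 leqnn ltnn mulr1 mulr0 addr0.
Qed.

(** * Exponentially small levels *)

Lemma expRN_le1 (R : realType) (r : R) (n : nat) :
  0 <= r -> 0 < expR (- r * n%:R) <= 1.
Proof.
by move=> r0; rewrite expR_gt0 -expR0 ler_expR mulNr oppr_le0 mulr_ge0.
Qed.

Lemma eps_eq1 (R : realType) (lambda : R) (l n z : nat) (delta : R) :
  0 <= lambda <= 1 -> 0 < delta <= 1 -> (z <= n.+1)%N ->
  hit lambda l n z = hitlast lambda l n z -> delta <= hitlast lambda l n z ->
  eps lambda l n delta = 1.
Proof.
move=> lam d01 zn hE dh; apply/eqP; rewrite eq_le eps_le1 //=.
have := @eps_ge_level R lambda l n z delta lam d01 zn; rewrite hE => /(_ dh).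
by rewrite divff // gt_eqF // (lt_le_trans _ dh) //; case/andP: d01.
Qed.

(** Without failures, when exactly [k + 1] variables are 1, the event [L <= k]
    means [Y_{n+1} = 1]; this has probability [(k + 1) / (n + 1)], far above the exponential level. *)
Lemma eps0_exponential (R : realType) (r : R) (k : nat) : 0 < r ->
  \forall n \near \oo, eps 0 k n (expR (- r * n%:R)) = 1.
Proof.
move=> r0; have lam : 0 <= (0 : R) <= 1 by rewrite lexx ler01.
near=> n.
have kn : (k < n.+1)%N by rewrite ltnS; near: n; exact: nbhs_infty_ge.
have rn : (2 / r) ^+ 2 <= n%:R by near: n; exact: nbhs_infty_ger.
have lastE : hitlast 0 k n k.+1 = k.+1%:R / n.+1%:R :> R.
  by rewrite /hitlast B_lambda0 leqnn mulr1.
apply: (@eps_eq1 _ _ _ _ k.+1) => //; first exact/expRN_le1/ltW.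
  by rewrite /hit B_lambda0 ltnn mulr0 addr0.
rewrite lastE mulNr expRN ler_pdivlMr ?ltr0n // mulrC ler_pdivrMr ?expR_gt0 //.
apply: (@le_trans _ _ (expR (r * n%:R))); last first.
  by rewrite ler_peMl ?ler1n // expR_ge0.
have -> : r * n%:R = 2%:R * (r * n%:R / 2) by field.
rewrite expRM_natl.
have n0 : 0 <= n%:R :> R by [].
have y0 : 0 <= r * n%:R / 2 by rewrite divr_ge0 // mulr_ge0 // ltW.
have ey := expR_ge1Dx (r * n%:R / 2).
(* Squaring the linear bound at half the exponent gives quadratic growth. *)
apply: (@le_trans _ _ ((1 + r * n%:R / 2) ^+ 2)); last first.
  by rewrite ler_pXn2r // nnegrE ?expR_ge0 // addr_ge0.
have : n%:R <= (r * n%:R / 2) ^+ 2.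
  have -> : (r * n%:R / 2) ^+ 2 = n%:R * (n%:R * (r / 2) ^+ 2) by field.
  rewrite ler_peMr // -ler_pdivrMr ?exprn_gt0 ?divr_gt0 //.
  by rewrite mul1r -exprVn invf_div.
set y := _ / 2 in y0 *; move=> ny; rewrite -[n.+1%:R]natr1.
have -> : (1 + y) ^+ 2 = 1 + 2 * y + y ^+ 2 by ring.
lra.
Unshelve. all: by end_near. Qed.

Lemma expR_ln_exp (R : realType) (lambda : R) (n : nat) : 0 < lambda ->
  lambda ^+ n = expR (- (ln lambda^-1 * n%:R)).
Proof. by move=> l0; rewrite lnV // mulNr opprK expRM_natr lnK. Qed.

(** If all variables are 1, then [L <= l] has probability at least
    [lambda ^ n], which is at least [exp (- r n)], and [Y_{n+1} = 1] is certain. *)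
Lemma eps_fast_exponential (R : realType) (lambda r : R) (l n : nat) :
  0 < lambda < 1 -> ln lambda^-1 < r ->
  eps lambda l n (expR (- r * n%:R)) = 1.
Proof.
move=> lam ar; have lam' : 0 <= lambda <= 1 by lra.
have /andP[l0 l1] := lam.
have a0 : 0 <= ln lambda^-1 by rewrite ln_ge0 // invf_ge1 // ltW.
have lastE : hitlast lambda l n n.+1 = B lambda n l.
  by rewrite /hitlast divff ?pnatr_eq0 // mul1r.
apply: (@eps_eq1 _ _ _ _ n.+1) => //.
- by apply: expRN_le1; lra.
- by rewrite /hit divff ?pnatr_eq0 // subrr mul0r addr0.
rewrite lastE; apply: le_trans (B_ge_exp n l lam').
by rewrite expR_ln_exp // ler_expR mulNr lerN2 ler_wpM2r // ltW.
Qed.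

(** With [rho = r / ln lambda^-1], the largest feasible level [z] is about
    [rho * n], since [hit z] is [lambda ^ z] up to polynomial factors. *)
Lemma eps_slow_lower (R : realType) (lambda r e : R) (l : nat) :
  0 < lambda < 1 -> 0 < r <= ln lambda^-1 -> 0 < e ->
  \forall n \near \oo,
    r / (r + lambda * (ln lambda^-1 - r)) - e <=
    eps lambda l n (expR (- r * n%:R)).
Proof.
move=> lam /andP[r0 ra] e0; have lam' : 0 <= lambda <= 1 by lra.
set a := ln lambda^-1; have a0 : 0 < a by rewrite (lt_le_trans r0).
have l0 : 0 < lambda by lra.
set v := r / _; pose rho := r / a.
have rho0 : 0 < rho by rewrite divr_gt0.
have rho1 : rho <= 1 by rewrite ler_pdivrMr // mul1r.
have den0 : 0 < r + lambda * (a - r).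
  by rewrite ltr_pwDl // mulr_ge0 ?subr_ge0 // ltW.
have v1 : v <= 1.
  by rewrite ler_pdivrMr // mul1r lerDl mulr_ge0 ?subr_ge0 // ltW.
have v0 : 0 < v by rewrite divr_gt0.
have vE : rho * (1 - (1 - lambda) * v) = v * lambda.
  by rewrite /rho /v; field; rewrite !gt_eqF.
near=> n.
have nbig : (l%:R + 2) / (e * lambda) <= n%:R.
  by near: n; exact: nbhs_infty_ger.
have nrho : (l%:R + 2) / rho <= n%:R by near: n; exact: nbhs_infty_ger.
rewrite ler_pdivrMr ?mulr_gt0 // in nbig.
rewrite ler_pdivrMr // in nrho.
set z := Num.truncn (rho * n%:R).
have rn0 : 0 <= rho * n%:R by rewrite mulr_ge0 // ltW.
have /andP[zle zgt] := truncn_itv rn0; rewrite -/z -natr1 in zle zgt.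
have zn : (z <= n)%N.
  by rewrite -(ler_nat R) (le_trans zle) // ler_piMl.
set delta := expR _.
have dz : delta <= hit lambda l n z.
  apply: le_trans _ (B_le_hit l n z lam'); apply: le_trans (B_ge_exp z l lam').
  rewrite expR_ln_exp // ler_expR mulNr lerN2 -/a.
  by rewrite -ler_pdivlMl // mulrA [_^-1 * _]mulrC.
apply: le_trans _ (eps_ge_level lam' (expRN_le1 n (ltW r0)) (leqW zn) dz).
have zl : (l < z)%N by rewrite -(ltr_nat R); lra.
have d0 : 0 < delta by exact: expR_gt0.
rewrite ler_pdivlMr ?(lt_le_trans d0) //.
have B0 : 0 <= B lambda z.-1 l by exact: B_ge0.
have Bz : (z%:R - l%:R) * B lambda z l <= lambda * z%:R * B lambda z.-1 l.
  by case: (z) zl => // y _; exact: B_ratio_le.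
have last0 := hitlast_ge0 l n z lam'.
have [neg|pos] := leP (v - e) 0.
  by rewrite (le_trans _ last0) // mulr_le0_ge0 // (le_trans (ltW d0)).
have w0 : 0 < z%:R - l%:R :> R by rewrite subr_gt0 ltr_nat.
have N0 : 0 < n.+1%:R :> R by [].
(* The ratio [B z / B z.-1] is at most [lambda * z / (z - l)], so this is the
   wanted inequality after clearing denominators. *)
have key : (v - e) * ((z%:R - l%:R) + lambda * (n.+1%:R - z%:R)) <= z%:R - l%:R.
  have nuv : 0 <= 1 - (1 - lambda) * v <= 1.
    have nu0 : 0 <= 1 - lambda by lra.
    have h : 0 <= (1 - lambda) * v by rewrite mulr_ge0 // ltW.
    have h' : (1 - lambda) * v <= 1.
      by rewrite mulr_ile1 // ?ltW //; lra.
    lra.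
  have h1 : (rho * n%:R - 1 - l%:R) * (1 - (1 - lambda) * v) <=
      (z%:R - l%:R) * (1 - (1 - lambda) * v).
    by rewrite ler_wpM2r //; lra.
  have h2 : (1 + l%:R) * (1 - (1 - lambda) * v) <= 1 + l%:R :> R.
    by rewrite ler_piMr ?addr_ge0 //; lra.
  have h3 : 0 <= (z%:R - l%:R) * (1 - lambda) * e.
    by rewrite !mulr_ge0 //; lra.
  have h4 : rho * n%:R * (1 - (1 - lambda) * v) = v * lambda * n%:R.
    by rewrite mulrAC vE.
  have h5 : v * lambda <= 1 by rewrite mulr_ile1 //; lra.
  have h6 : 0 <= (v - e) * lambda * l%:R by rewrite !mulr_ge0 //; lra.
  have h7 : 0 <= e * lambda by rewrite mulr_ge0 //; lra.
  rewrite -natr1; lra.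
rewrite -(ler_pM2l w0) -(ler_pM2l N0).
have zb0 : 0 <= z%:R * B lambda z.-1 l by rewrite mulr_ge0.
have zn' : 0 <= n.+1%:R - z%:R :> R by rewrite subr_ge0 ler_nat leqW.
apply: (@le_trans _ _ ((v - e) * ((z%:R - l%:R) + lambda * (n.+1%:R - z%:R)) *
    (z%:R * B lambda z.-1 l))).
  have := ler_wpM2l (mulr_ge0 (ltW pos) zn') Bz.
  rewrite /hit /hitlast.
  have -> : n.+1%:R * ((z%:R - l%:R) * ((v - e) *
      (z%:R / n.+1%:R * B lambda z.-1 l +
       (1 - z%:R / n.+1%:R) * B lambda z l))) =
      (v - e) * (z%:R - l%:R) * (z%:R * B lambda z.-1 l) +
      (v - e) * (n.+1%:R - z%:R) * ((z%:R - l%:R) * B lambda z l).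
    by field; rewrite addrC natr1 pnatr_eq0.
  lra.
apply: le_trans (ler_wpM2r zb0 key) _.
rewrite le_eqVlt; apply/orP; left; apply/eqP; rewrite /hitlast.
by field; rewrite addrC natr1 pnatr_eq0.
Unshelve. all: by end_near. Qed.

(** Levels well below [rho * n] have too small a ratio of [hitlast] to [hit];
    those well above are so unlikely that their contribution to the
    probability of [L <= l] is negligible against [delta]. *)
Lemma eps_slow_upper (R : realType) (lambda r e : R) (l : nat) :
  0 < lambda < 1 -> 0 < r <= ln lambda^-1 -> 0 < e ->
  \forall n \near \oo,
    eps lambda l n (expR (- r * n%:R)) <=
    r / (r + lambda * (ln lambda^-1 - r)) + e.
Proof.
move=> lam /andP[r0 ra] e0; have lam' : 0 <= lambda <= 1 by lra.
set a := ln lambda^-1; have a0 : 0 < a by rewrite (lt_le_trans r0).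
have l0 : 0 < lambda by lra.
set v := r / _; pose rho := r / a.
have rho0 : 0 < rho by rewrite divr_gt0.
have den0 : 0 < r + lambda * (a - r).
  by rewrite ltr_pwDl // mulr_ge0 ?subr_ge0 // ltW.
have v1 : v <= 1.
  by rewrite ler_pdivrMr // mul1r lerDl mulr_ge0 ?subr_ge0 // ltW.
have v0 : 0 < v by rewrite divr_gt0.
have vE : rho * (1 - (1 - lambda) * v) = v * lambda.
  by rewrite /rho /v; field; rewrite !gt_eqF.
(* Allowing an excess [e / 2] over the ratio [v] covers the levels up to
   [(rho + kappa) * n]. *)
pose kappa := e / 2 * lambda.
have kappa0 : 0 < kappa by rewrite mulr_gt0 // divr_gt0.
(* A decay rate below [a] that still beats [r * n] at the level
   [(rho + kappa) * n]. *)
pose a' := r / (rho + kappa / 2).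
have a'0 : 0 < a' by rewrite divr_gt0 // addr_gt0 // divr_gt0.
have a'E : a' * (rho + kappa / 2) = r by rewrite divfK // gt_eqF //; lra.
have a'a : a' < a.
  rewrite ltr_pdivrMr; last by lra.
  by rewrite mulrDr [a * rho]mulrC divfK ?gt_eqF // ltrDl mulr_gt0 // divr_gt0.
have mu1 : lambda < expR (- a') < 1.
  rewrite -{1}(@lnK _ lambda) ?posrE // -expR0 !ltr_expR oppr_lt0 a'0 andbT.
  by rewrite ltrNr -lnV.
have [C C0 BC] := B_geometric l l0 mu1.
near=> n.
have nbig : C * expR a' / (e / 2) / (a' * (kappa / 2)) <= n%:R.
  by near: n; exact: nbhs_infty_ger.
have e20 : 0 < e / 2 by lra.
have th0 : 0 < a' * (kappa / 2) by rewrite mulr_gt0 // divr_gt0.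
rewrite !ler_pdivrMr // in nbig.
set delta := expR _; have d01 : 0 < delta <= 1 by apply/expRN_le1/ltW.
rewrite [e]splitr addrA; apply: eps_le_of_levels => //; first exact: ltW.
move=> z zn.
set N : R := n.+1%:R; have N0 : 0 < N by [].
have hit0 : 0 <= hit lambda l n z.
  exact: le_trans (B_ge0 z l lam') (B_le_hit l n z lam').
have nu0 : 0 <= 1 - lambda by lra.
have [small|large] := leP (z%:R * (1 - (1 - lambda) * (v + e / 2)))
    ((v + e / 2) * lambda * N).
  (* Here [lambda * B z.-1 <= B z] is all that is needed. *)
  apply: (@le_trans _ _ ((v + e / 2) * hit lambda l n z)); last first.
    by rewrite lerDl mulr_ge0 ?expR_ge0 // ltW.
  have B0 := B_ge0 z.-1 l lam'.
  have zN : 0 <= N - z%:R by rewrite subr_ge0 ler_nat.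
  have ge_lambda : lambda * B lambda z.-1 l <= B lambda z l.
    case: (z) => [|y]; last exact: B_ratio_ge.
    by rewrite ler_piMl ?B_ge0 // ltW //; lra.
  have u0 : 0 <= v + e / 2 by lra.
  have h1 := ler_wpM2r B0 small.
  have h2 := ler_wpM2l (mulr_ge0 u0 zN) ge_lambda.
  rewrite -(ler_pM2l N0) /hit /hitlast -/N.
  have -> : N * (z%:R / N * B lambda z.-1 l) = z%:R * B lambda z.-1 l.
    by field; rewrite gt_eqF.
  have -> : N * ((v + e / 2) * (z%:R / N * B lambda z.-1 l +
       (1 - z%:R / N) * B lambda z l)) =
      (v + e / 2) * (z%:R * B lambda z.-1 l) +
      (v + e / 2) * (N - z%:R) * B lambda z l.
    by field; rewrite gt_eqF.
  lra.
(* Here [z] exceeds [(rho + kappa) * n], and [hitlast z <= B z.-1] decays like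
   [exp (- a' z)], faster than [delta]. *)
rewrite -[leLHS]add0r lerD ?mulr_ge0 //; first lra.
have nuv : 1 - (1 - lambda) * v <= 1.
  by rewrite gerBl mulr_ge0 // ltW.
have rk : (rho + kappa) * N < z%:R.
  have h1 : z%:R * (1 - (1 - lambda) * v) <= z%:R by rewrite ler_piMr.
  have h2 : 0 <= z%:R * ((1 - lambda) * (e / 2)) by rewrite !mulr_ge0 // ltW.
  have h3 : rho * N * (1 - (1 - lambda) * v) = v * lambda * N.
    by rewrite mulrAC vE.
  have : (rho * (1 - (1 - lambda) * v) + kappa) * N < z%:R * (1 - (1 - lambda) * v).
    by rewrite vE /kappa; lra.
  have q0 : 0 < 1 - (1 - lambda) * v.
    by rewrite -(pmulr_rgt0 _ rho0) vE mulr_gt0.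
  have : kappa * N * (1 - (1 - lambda) * v) <= kappa * N.
    by rewrite ler_piMr // mulr_ge0 // ltW.
  by move=> h4 h5; rewrite -(ltr_pM2r q0); lra.
have z1 : (0 < z)%N.
  by rewrite -(ltr_nat R) (le_lt_trans _ rk) // mulr_ge0 ?addr_ge0 // ltW.
apply: (@le_trans _ _ (B lambda z.-1 l)).
  by rewrite ler_piMl ?B_ge0 // frac_le1.
apply: (le_trans (BC _)); rewrite -expRM_natr.
apply: (@le_trans _ _ (C * (expR a' / expR (a' * (kappa / 2) * n%:R) * delta))).
  rewrite ler_wpM2l ?(ltW C0) // /delta -expRN -!expRD ler_expR.
  have -> : z.-1%:R = z%:R - 1 :> R by rewrite -{2}(prednK z1) -natr1 addrK.
  have h1 : a' * ((rho + kappa) * n%:R) <= a' * z%:R.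
    rewrite ler_wpM2l ?(ltW a'0) // (le_trans _ (ltW rk)) // ler_wpM2l //.
      by rewrite addr_ge0 // ltW.
    by rewrite ler_nat.
  rewrite -a'E; lra.
rewrite mulrA ler_wpM2r ?expR_ge0 // mulrA ler_pdivrMr ?expR_gt0 //.
apply: le_trans (nbig) _; rewrite mulrC ler_wpM2l ?(ltW e20) //.
have := expR_ge1Dx (a' * (kappa / 2) * n%:R); lra.
Unshelve. all: by end_near. Qed.

Lemma eps_slow_exponential (R : realType) (lambda r : R) (l : nat) :
  0 < lambda < 1 -> 0 < r <= ln lambda^-1 ->
  (fun n : nat => eps lambda l n (expR (- r * n%:R)))
    = (fun=> r / (r + lambda * (ln lambda^-1 - r))) +o_\oo (fun=> 1 : R).
Proof.
move=> lam ra; apply/eqaddoP => e e0; near=> n.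
rewrite normr1 mulr1 ler_norml; apply/andP; split.
  rewrite lerBrDl; near: n; exact: (eps_slow_lower l lam ra e0).
rewrite lerBlDl; near: n; exact: (eps_slow_upper l lam ra e0).
Unshelve. all: by end_near. Qed.

Unset Implicit Arguments.

Theorem theorem5p1 (R : realType) (lambda : R) (k0 : nat) :
  0 < lambda < 1 ->
  (forall delta : R, 0 < delta < 1 ->
     ((fun n : nat => eps 0 k0 n delta)
        = (fun n : nat => (k0%:R + 1 - delta) / delta * n%:R^-1)
        +o_\oo (fun n : nat => n%:R^-1 : R))
     /\
     ((fun n : nat => eps lambda (ceil_nu lambda k0) n delta)
        = (fun n : nat => G (ceil_nu lambda k0) delta lambda * n%:R^-1)
        +o_\oo (fun n : nat => n%:R^-1 : R)))
  /\
  (forall r : R, 0 < r ->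
     [/\ \forall n \near \oo, eps 0 k0 n (expR (- r * n%:R)) = 1,
         ln lambda^-1 < r ->
           \forall n \near \oo,
             eps lambda (ceil_nu lambda k0) n (expR (- r * n%:R)) = 1
       & r <= ln lambda^-1 ->
           (fun n : nat => eps lambda (ceil_nu lambda k0) n (expR (- r * n%:R)))
             = (fun=> r / (r + lambda * (ln lambda^-1 - r)))
             +o_\oo (fun=> 1 : R)]).
Proof.
move=> lam; split => [delta del | r r0].
  by split; [exact: eps0_first_order | exact: eps_first_order].
split; first exact: eps0_exponential.
  by move=> ar; apply: nearW => n; exact: eps_fast_exponential.
by move=> ra; apply: eps_slow_exponential => //; rewrite r0.
Qed.
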